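(* There exists a universal constant $C>0$ such that the following holds. Let $t\in[0,1]$, and let $G$ be a probability distribution over $[0,\infty)$ with $G([0,1])\ge p>0$. Then $$\omega_{H^2,G}(t)\le C\begin{cases}\Big(\dfrac{t^3}{p^4}\Big)^{1/6}&\text{if }t\le p^{4/3},\\[2mm]\Big(\dfrac{t^3}{p^4}\Big)^{1/2}&\text{if }p^{4/3}<t\le\dfrac pC,\end{cases}$$ where $$\omega_{H^2,G}(t)=\sup\{|\mu_1-\mu_2|:\ \mu_1,\mu_2\in\mathbb{R},\ H^2(f_{\mu_1,G},f_{\mu_2,G})\le t\}.$$
   Context: For $\mu\in\mathbb{R}$ and a probability distribution $G$ on $[0,\infty)$, $f_{\mu,G}$ is the normal scale mixture $\mathbb{E}_{\sigma\sim G}[\mathcal{N}(\mu,\sigma^2)]$, with density $f_{\mu,G}(x)=\mathbb{E}_{\sigma\sim G}\big[\frac1\sigma\varphi\big(\frac{x-\mu}{\sigma}\big)\big]$ where $\varphi$ is the standard normal density (if $G$ has an atom at $0$, $\mathcal{N}(\mu,0)$ is the point mass at $\mu$ and $f_{\mu,G}$ is understood as a probability measure). The squared Hellinger distance is $H^2(P,Q)=\int(\sqrt{dP}-\sqrt{dQ})^2$ (no factor $1/2$). *)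

(* Defs.v *)
From HB Require Import structures.
From mathcomp Require Import all_boot all_order all_algebra.
From mathcomp Require Import all_classical all_reals all_analysis.
From mathcomp Require Import measurable_realfun.

Set Implicit Arguments.
Unset Strict Implicit.
Unset Printing Implicit Defensive.

Import Order.TTheory GRing.Theory Num.Theory.
Import numFieldNormedType.Exports.

Local Open Scope classical_set_scope.
Local Open Scope ring_scope.

(* The library's normal_prob m 0 is a junk value (the uniform law on [0, 1]),
   so the degenerate case N(m, 0) is set to the point mass at m here. *)
Definition normal_law (R : realType) (m s : R) :
    probability (measurableTypeR R) R :=
  if s == 0 then [the probability (measurableTypeR R) R of @dirac _ (measurableTypeR R) m R]
  else [the probability (measurableTypeR R) R of normal_prob m s].

Lemma measurable_normal_law (R : realType) (m : R)
    (A : set (measurableTypeR R)) : measurable A ->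
  measurable_fun [set: measurableTypeR R] (fun s => (normal_law m s A : \bar R)).
Proof.
move=> mA.
pose g := fun z : measurableTypeR R * measurableTypeR R =>
  ((z.1 ^+ 2 * pi *+ 2) `^ 2^-1) `^ (-1) *
  expR (- (z.2 - m) ^+ 2 * (z.1 ^+ 2 *+ 2) `^ (-1)) : R.
have gE s x : g (s, x) = normal_peak s * normal_fun m s x.
  rewrite /g /normal_peak /normal_fun /= !powR_inv1 ?powR_ge0//.
    by rewrite powR12_sqrt// mulrn_wge0// mulr_ge0 ?sqr_ge0 ?pi_ge0.
  by rewrite mulrn_wge0// sqr_ge0.
have mg : measurable_fun setT g.
  have m1 : measurable_fun setT
      (fun z : measurableTypeR R * measurableTypeR R => z.1 ^+ 2 : R).
    by apply: measurable_funX => //; exact: measurable_fst.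
  apply: measurable_funM.
    apply: (measurableT_comp (measurable_powR _)).
    apply: (measurableT_comp (measurable_powR _)).
    rewrite (_ : (fun z => _) = fun z => z.1 ^+ 2 * (pi *+ 2)).
      by apply: measurable_funM => //.
    by apply/funext => z; rewrite -mulrnAr.
  apply: measurableT_comp => //; apply: measurable_funM.
    apply: measurableT_comp => //; apply: measurable_funX.
    by apply: measurable_funB => //; exact: measurable_snd.
  apply: (measurableT_comp (measurable_powR _)).
  rewrite (_ : (fun z => _) = fun z => z.1 ^+ 2 * 2%:R).
    by apply: measurable_funM => //.
  by apply/funext => z; rewrite mulr_natr.
pose h := fun z : measurableTypeR R * measurableTypeR R =>
  (g z * \1_A z.2)%:E.
have mh : measurable_fun setT h.
  apply/measurable_EFinP; apply: measurable_funM => //.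
  by apply: measurableT_comp; [exact: measurable_indic|exact: measurable_snd].
have h0 z : (0 <= h z)%E.
  case: z => s x; rewrite /h gE lee_fin.
  by rewrite !mulr_ge0 ?normal_peak_ge0 ?normal_fun_ge0.
have mf := measurable_fun_fubini_tonelli_F (m2 := lebesgue_measure) h mh h0.
rewrite (_ : (fun s => _) =
    fun s => if s == 0 then (\1_A m)%:E else fubini_F lebesgue_measure h s).
  by apply: measurable_fun_ifT => //; exact: measurable_fun_eqr.
apply/funext => s; rewrite /normal_law; have [//|s0] := eqVneq s 0.
rewrite /= /normal_prob integral_mkcond; apply: eq_integral => x _.
rewrite /h gE /= patchE normal_pdfE// indicE.
by case: ifPn => xA; rewrite ?mulr1 ?mulr0.
Qed.

Section scale_mixture.
Context {R : realType}.
Variables (m : R) (G : probability (measurableTypeR R) R).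
Local Open Scope ereal_scope.

Definition scale_mixture (A : set (measurableTypeR R)) : \bar R :=
  \int[G]_s normal_law m s A.

Let scale_mixture0 : scale_mixture set0 = 0.
Proof.
by rewrite /scale_mixture integral0_eq// => s _; rewrite measure0.
Qed.

Let scale_mixture_ge0 A : 0 <= scale_mixture A.
Proof. by apply: integral_ge0. Qed.

Let scale_mixture_sigma_additive : semi_sigma_additive scale_mixture.
Proof.
move=> F mF tF mUF.
have -> : scale_mixture (\bigcup_n F n) =
    \int[G]_s (\sum_(n <oo) normal_law m s (F n)).
  apply: eq_integral => s _.
  by apply/esym/cvg_lim => //; exact: measure_semi_sigma_additive.
rewrite integral_nneseries//; last first.
  by move=> n; exact: measurable_normal_law.
by apply: is_cvg_nneseries => n _ _; exact: integral_ge0.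
Qed.

HB.instance Definition _ := isMeasure.Build _ _ _ scale_mixture
  scale_mixture0 scale_mixture_ge0 scale_mixture_sigma_additive.

Let scale_mixture_setT : scale_mixture setT = 1.
Proof.
rewrite /scale_mixture; under eq_integral do rewrite probability_setT.
by rewrite integral_cst// mul1e; exact: probability_setT.
Qed.

HB.instance Definition _ := @Measure_isProbability.Build _ _ R
  scale_mixture scale_mixture_setT.

End scale_mixture.

Section measure_add_finite.
Context d (T : measurableType d) (R : realType).
Variables P Q : {finite_measure set T -> \bar R}.

Let measure_add_fin : fin_num_fun (measure_add P Q).
Proof.
by move=> A mA; rewrite measure_addE fin_numD !fin_num_measure.
Qed.

HB.instance Definition _ := Measure.on (measure_add P Q).
HB.instance Definition _ :=
  Measure_isFinite.Build _ _ _ (measure_add P Q) measure_add_fin.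

Lemma dominates_measure_addl : P `<< measure_add P Q.
Proof.
apply/null_content_dominatesP => A mA.
have := measure_addE P Q A => /= -> /eqP.
by rewrite padde_eq0// => /andP[/eqP ->].
Qed.

Lemma dominates_measure_addr : Q `<< measure_add P Q.
Proof.
apply/null_content_dominatesP => A mA.
have := measure_addE P Q A => /= -> /eqP.
by rewrite padde_eq0// => /andP[_ /eqP ->].
Qed.

End measure_add_finite.

Local Open Scope charge_scope.

(* \int (sqrt dP - sqrt dQ)^2 does not depend on the dominating measure with
   respect to which the two densities are taken; P + Q is used here. *)
Definition hellinger2 d (T : measurableType d) (R : realType)
    (P Q : probability T R) : \bar R :=
  let nu := [the {finite_measure set T -> \bar R} of measure_add P Q] in
  let dens (M : probability T R) x :=
    fine (('d (charge_of_finite_measure M) '/d nu) x) in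
  (\int[nu]_x ((Num.sqrt (dens P x) - Num.sqrt (dens Q x)) ^+ 2)%:E)%E.

Definition hellinger_modulus (R : realType)
    (G : probability (measurableTypeR R) R) (t : R) : \bar R :=
  ereal_sup [set x | exists m1 m2 : R,
    (hellinger2 (scale_mixture m1 G) (scale_mixture m2 G) <= t%:E)%E /\
    x = `|m1 - m2|%:E].

(* Main.v *)
Require Import Defs.
From mathcomp Require Import all_boot all_order all_algebra.
From mathcomp Require Import all_classical all_reals all_analysis.
From mathcomp Require Import measurable_realfun.
From mathcomp Require Import ring lra.

Set Implicit Arguments.
Unset Strict Implicit.
Unset Printing Implicit Defensive.

Import Order.TTheory GRing.Theory Num.Theory.
Import numFieldNormedType.Exports.

Local Open Scope classical_set_scope.
Local Open Scope ring_scope.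

(** Put D = |m1 - m2|, r = sqrt t, and let F (a, b) be the mass that the mixture
    centred at 0 gives to [a, b[; by translation, the two mixtures give an
    interval the masses F (a, b) and F (a + D, b + D). Restricting the Hellinger
    integral to an interval and using the triangle inequality in L^2
    ([hellinger2_ge_disjoint]) gives, for every interval,
      |sqrt (F (a, b)) - sqrt (F (a + D, b + D))| <= r,
    hence an increment of F under the shift is at most 2 r sqrt (F (a, b))
    ([increment_le]). Besides this, the proof uses only that F is the profile of a
    symmetric unimodal law having a component of weight p at scale at most 1
    ([profile]), and it plays two estimates against each other.

    Upper bound on the density near the centre: comparing the half-line to the
    right of the centre with its shift gives F (0, D) <= 2 r
    ([mass_shift_le]), and unimodality spreads this to other intervals.

    Lower bound on the same density: near the centre the component of weight p
    makes F change by an amount of order p min (D, 1) under the shift, while the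
    square roots change by at most r only; so F must already be large there, of
    order (p min (D, 1) / r)^2.
    - If D <= 18, the interval [-D/2, 48[ loses mass D p / 48 at least, so its
      mass is at least of order (p D / r)^2; it is at most of order r / D by the
      upper bound, whence p^2 D^3 <= K r^3 ([separation_small]), which is the
      exponent 1/6.
    - If D >= 18, the interval [-2, 2[ loses mass p / 2 at least. If moreover
      8 t <= p, then both it and its shift have mass of order (p / r)^2 at least,
      and the mass of the shift is at most 4 F (0, D) / (D - 2) by unimodality,
      whence p^2 D <= K r^3 ([separation_large]), which is the exponent 1/2.

    The case t <= p^(4/3), p < 8 t is left. Then p and t are bounded below, and
    it is enough to bound D: the sets [m1 - 2, m1 + 2[ and [m2 - 2, m2 + 2[
    each contribute nearly 3 p / 4 to the Hellinger distance when D is large,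
    more than t <= p in total ([separation_bounded]). *)

(** * Hellinger distance and masses of sets *)

Section hellinger.
Context {d} {T : measurableType d} {R : realType}.
Local Open Scope charge_scope.

(** The density integrated in [hellinger2], for an arbitrary dominating measure. *)
Definition density (M nu : {finite_measure set T -> \bar R}) (x : T) : R :=
  fine (('d (charge_of_finite_measure M) '/d nu) x).

Lemma measurable_density (M nu : {finite_measure set T -> \bar R}) :
  M `<< nu -> measurable_fun setT (density M nu).
Proof. by move=> dom; exact: measurableT_comp. Qed.

Lemma measurable_sqrt_density (M nu : {finite_measure set T -> \bar R}) :
  M `<< nu -> measurable_fun setT (fun x => Num.sqrt (density M nu x)).
Proof.
move=> dom; apply: (@measurableT_comp _ _ _ _ _ _ (@Num.sqrt R)).
  by apply: continuous_measurable_fun; exact: sqrt_continuous.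
exact: measurable_density.
Qed.

(** The derivative of a charge may be negative on a null set; squaring the square
    root removes the negative part, and the nonnegative derivative of the measure
    agrees almost everywhere with what is left. *)
Lemma integral_sqr_sqrt_density (M nu : {finite_measure set T -> \bar R})
    (A : set T) : M `<< nu -> measurable A ->
  (\int[nu]_(x in A) ((Num.sqrt (density M nu x)) ^+ 2)%:E = M A)%E.
Proof.
move=> dom mA.
rewrite (Radon_Nikodym_SigmaFinite.f_integral dom mA).
apply: ge0_ae_eq_integral => //.
- apply: measurable_funTS; apply/measurable_EFinP.
  by apply: measurable_funX; exact: measurable_sqrt_density.
- apply: measurable_funTS; apply: measurable_int.
  exact: Radon_Nikodym_SigmaFinite.f_integrable.
- by move=> x _; exact: Radon_Nikodym_SigmaFinite.f_ge0.
- have := ae_eq_Radon_Nikodym_SigmaFinite dom mA.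
  apply: filterS => x + Ax => /(_ Ax) h.
  have f0 := Radon_Nikodym_SigmaFinite.f_ge0 dom x.
  have ff := Radon_Nikodym_SigmaFinite.f_fin_num dom x.
  by rewrite /density -h sqr_sqrtr ?fine_ge0// fineK.
Qed.

(** The triangle inequality in L^2 for the square roots u, v of the densities.
    Integrating (u - v)^2 + k u^2 + v^2 / k >= u^2 + v^2, that is
    2 u v <= k u^2 + v^2 / k, and then choosing k replaces the Cauchy-Schwarz
    inequality. *)
Lemma sqr_sub_sqrt_le_integral (P Q nu : {finite_measure set T -> \bar R})
    (A : set T) : P `<< nu -> Q `<< nu -> measurable A ->
  (((Num.sqrt (fine (P A)) - Num.sqrt (fine (Q A))) ^+ 2)%:E <=
   \int[nu]_(x in A)
     ((Num.sqrt (density P nu x) - Num.sqrt (density Q nu x)) ^+ 2)%:E)%E.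
Proof.
move=> domP domQ mA.
set u := fun x => Num.sqrt (density P nu x).
set v := fun x => Num.sqrt (density Q nu x).
have mu : measurable_fun A u.
  by apply: measurable_funTS; exact: measurable_sqrt_density.
have mv : measurable_fun A v.
  by apply: measurable_funTS; exact: measurable_sqrt_density.
have mu2 : measurable_fun A (fun x => u x ^+ 2) by exact: measurable_funX.
have mv2 : measurable_fun A (fun x => v x ^+ 2) by exact: measurable_funX.
have muv2 : measurable_fun A (fun x => (u x - v x) ^+ 2).
  by apply: measurable_funX; exact: measurable_funB.
set I := (X in (_ <= X)%E).
have [->|Ifin] := eqVneq I +oo%E; first by rewrite leey.
have I0 : (0 <= I)%E by apply: integral_ge0 => x _; rewrite lee_fin sqr_ge0.
have {}Ifin : I \is a fin_num by rewrite ge0_fin_numE// lt_neqAle Ifin leey.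
have scaled k : 0 < k ->
    fine (P A) + fine (Q A) <= fine I + k * fine (P A) + k^-1 * fine (Q A).
  move=> k0; rewrite -lee_fin !EFinD !EFinM !fineK ?fin_num_measure//.
  rewrite -(integral_sqr_sqrt_density domP mA) -(integral_sqr_sqrt_density domQ mA).
  have k_ge0 := ltW k0.
  have kV : 0 <= k^-1 by rewrite invr_ge0.
  rewrite -!ge0_integralZl//; try (by move=> x _; rewrite lee_fin sqr_ge0);
    try (by apply/measurable_EFinP); try (by rewrite lee_fin ltW).
  have mk : measurable_fun A (fun x => k * u x ^+ 2) by exact: measurable_funM.
  have mkV : measurable_fun A (fun x => k^-1 * v x ^+ 2) by exact: measurable_funM.
  rewrite -!ge0_integralD//; try (by apply/measurable_EFinP);
    try (by move=> x _; rewrite -?EFinM -?EFinD lee_fin ?addr_ge0 ?sqr_ge0 ?mulr_ge0 ?sqr_ge0);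
    try (by apply/measurable_EFinP; apply: measurable_funD).
  apply: ge0_le_integral => //.
  - by move=> x _; rewrite -EFinD lee_fin addr_ge0 ?sqr_ge0.
  - by apply/measurable_EFinP; apply: measurable_funD.
  - apply/measurable_EFinP; apply: measurable_funD => //; exact: measurable_funD.
  move=> x _; rewrite -!EFinM -!EFinD lee_fin -subr_ge0 -/(u x) -/(v x).
  (* the difference is the square of sqrt k * u - v / sqrt k *)
  rewrite (_ : _ - (_ + _) = (k * u x - v x) ^+ 2 / k); last by field; rewrite gt_eqF.
  by rewrite divr_ge0 ?sqr_ge0// ltW.
rewrite -[leRHS]fineK// lee_fin.
set a := Num.sqrt (fine (P A)); set b := Num.sqrt (fine (Q A)).
have Pa : fine (P A) = a ^+ 2 by rewrite sqr_sqrtr// fine_ge0.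
have Qb : fine (Q A) = b ^+ 2 by rewrite sqr_sqrtr// fine_ge0.
have a0 : 0 <= a := sqrtr_ge0 _.
have b0 : 0 <= b := sqrtr_ge0 _.
rewrite Pa Qb in scaled.
apply/ler_addgt0Pr => e e0.
(* k = b / a is optimal; both square roots are shifted by h to avoid dividing by zero *)
set h := e / (a + b + 1).
have h0 : 0 < h by rewrite divr_gt0// ltr_wpDl// addr_ge0.
have he : h * (a + b) <= e.
  rewrite /h mulrAC ler_pdivrMr ?ler_pM2l//; last by rewrite ltr_wpDl// addr_ge0.
  by rewrite lerDl.
have ah : 0 < a + h by rewrite ltr_wpDl.
have bh : 0 < b + h by rewrite ltr_wpDl.
have := scaled ((b + h) / (a + h)) (divr_gt0 bh ah); rewrite invf_div => H.
have Ha : (b + h) / (a + h) * a ^+ 2 <= (b + h) * a.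
  rewrite mulrAC ler_pdivrMr// -mulrA ler_wpM2l ?(ltW bh)//.
  by rewrite expr2 ler_wpM2l// lerDl ltW.
have Hb : (a + h) / (b + h) * b ^+ 2 <= (a + h) * b.
  rewrite mulrAC ler_pdivrMr// -mulrA ler_wpM2l ?(ltW ah)//.
  by rewrite expr2 ler_wpM2l// lerDl ltW.
nra.
Qed.

End hellinger.

Lemma hellinger2_ge_disjoint d (T : measurableType d) (R : realType)
    (P Q : probability T R) (A B : set T) :
  measurable A -> measurable B -> [disjoint A & B] ->
  (((Num.sqrt (fine (P A)) - Num.sqrt (fine (Q A))) ^+ 2 +
    (Num.sqrt (fine (P B)) - Num.sqrt (fine (Q B))) ^+ 2)%:E <=
   hellinger2 P Q)%E.
Proof.
move=> mA mB AB; rewrite /hellinger2.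
set nu := [the {finite_measure set T -> \bar R} of measure_add P Q].
have domP : P `<< nu by exact: dominates_measure_addl.
have domQ : Q `<< nu by exact: dominates_measure_addr.
have mh : measurable_fun setT (fun x => ((Num.sqrt (density P nu x) -
    Num.sqrt (density Q nu x)) ^+ 2)%:E).
  apply/measurable_EFinP; apply: measurable_funX; apply: measurable_funB;
  exact: measurable_sqrt_density.
have h0 x : (0 <= ((Num.sqrt (density P nu x) -
    Num.sqrt (density Q nu x)) ^+ 2)%:E)%E by rewrite lee_fin sqr_ge0.
apply: (@le_trans _ _ (\int[nu]_(x in A `|` B) ((Num.sqrt (density P nu x) -
    Num.sqrt (density Q nu x)) ^+ 2)%:E)%E); last first.
  by apply: ge0_subset_integral => //; exact: measurableU.
rewrite ge0_integral_setU//; last exact: measurable_funTS.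
by rewrite EFinD leeD// sqr_sub_sqrt_le_integral.
Qed.

(** * Affine change of variables and the standard normal law *)

Section affine.
Context {R : realType}.
Notation mu := (@lebesgue_measure R).

Lemma derive1_affine (m c : R) :
  (fun x : R => m + c * x)^`()%classic = cst c.
Proof.
apply/funext => x; rewrite derive1E.
by rewrite deriveD// derive_cst add0r deriveM// derive_cst derive_id scaler0 addr0 /GRing.scale/= mulr1.
Qed.

Lemma continuous_affine (m c : R) : continuous (fun x : R => m + c * x).
Proof.
by move=> x; apply: cvgD; [exact: cvg_cst|apply: cvgMr; exact: cvg_id].
Qed.

Lemma integral_affine_itv (G : R -> R) (m c a b : R) : continuous G -> 0 < c ->
  a <= b ->
  (\int[mu]_(x in `[(m + c * a)%R, (m + c * b)%R]) (G x)%:E =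
   \int[mu]_(x in `[a, b]) (G (m + c * x) * c)%:E)%E.
Proof.
move=> cG c0 ab.
rewrite (@integration_by_substitution_increasing _ (fun x => m + c * x)%R)//.
- apply: eq_integral => x _; congr EFin.
  by rewrite derive1_affine.
- by move=> x y _ _ xy; rewrite ltrD2l ltr_pM2l.
- by rewrite derive1_affine => x _; exact: cvg_cst.
- by rewrite derive1_affine; exact: is_cvg_cst.
- by rewrite derive1_affine; exact: is_cvg_cst.
- split => //.
  + by apply: cvg_at_right_filter; exact: continuous_affine.
  + by apply: cvg_at_left_filter; exact: continuous_affine.
- by apply: continuous_subspaceT.
Qed.

Lemma integral_affine_ray (G : R -> R) (m c a : R) : continuous G ->
  (forall x, 0 <= G x) -> 0 < c ->
  (\int[mu]_(x in `[(m + c * a)%R, +oo[) (G x)%:E =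
   \int[mu]_(x in `[a, +oo[) (G (m + c * x) * c)%:E)%E.
Proof.
move=> cG G0 c0.
rewrite (@increasing_ge0_integration_by_substitutiony _ (fun x => m + c * x)%R)//.
- apply: eq_integral => x _; congr EFin.
  by rewrite derive1_affine.
- by move=> x y _ _ xy; rewrite ltrD2l ltr_pM2l.
- by rewrite derive1_affine => x _; exact: cvg_cst.
- by rewrite derive1_affine; exact: is_cvg_cst.
- by rewrite derive1_affine; exact: is_cvg_cst.
- split => //.
  by apply: cvg_at_right_filter; exact: continuous_affine.
- apply: (cvg_comp _ _ _ (cvg_addrl m)).
  by apply: gt0_cvgMry => //; exact: cvg_id.
- by apply: continuous_subspaceT.
Qed.

End affine.

Section gauss.
Context {R : realType}.
Notation mu := (@lebesgue_measure R).
Notation phi := (normal_pdf (0 : R) 1).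

Lemma normal_pdf_std (m s x : R) : 0 < s ->
  normal_pdf m s (m + s * x) * s = phi x.
Proof.
move=> s0; rewrite !normal_pdfE ?gt_eqF//.
rewrite /normal_peak /normal_fun.
rewrite addrAC subrr add0r subr0 expr1n mul1r.
rewrite -mulrnAr sqrtrM ?sqr_ge0// sqrtr_sqr gtr0_norm// invfM.
rewrite (_ : - (s * x) ^+ 2 / (s ^+ 2 *+ 2) = - x ^+ 2 / (1 *+ 2)).
  by field; rewrite ?gt_eqF// sqrtr_gt0 mulr2n addr_gt0 ?pi_gt0.
by field; rewrite gt_eqF.
Qed.

Lemma normal_pdf_norm (m s : R) : normal_pdf m `|s| = normal_pdf m s.
Proof.
by apply/funext => x; rewrite /normal_pdf normr_eq0 /normal_peak /normal_fun real_normK ?num_real.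
Qed.

(** Translation and scaling reduce every nondegenerate component to the standard
    law; the density depends on the scale through its square, whence the absolute
    values. *)
Lemma normal_law_std (m s a b : R) : s != 0 -> a <= b ->
  normal_law m s `[m + a, m + b[%classic =
  normal_prob 0 1 `[a / `|s|, b / `|s|[%classic.
Proof.
move=> s0 ab; rewrite /normal_law (negbTE s0) /= /normal_prob.
have s1 : 0 < `|s| by rewrite normr_gt0.
rewrite !integral_itv_bndo_bndc; last 2 first.
  1,2: apply: measurable_funTS; apply/measurable_EFinP; exact: measurable_normal_pdf.
under eq_integral do rewrite -normal_pdf_norm.
rewrite -[in LHS](mulVKf (lt0r_neq0 s1) a) -[in LHS](mulVKf (lt0r_neq0 s1) b).
rewrite integral_affine_itv//; last 2 first.
- by apply: continuous_normal_pdf; rewrite normr_eq0.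
- by rewrite ler_pM2l ?invr_gt0.
rewrite ![_^-1 * _]mulrC; apply: eq_integral => x _.
by rewrite normal_pdf_std.
Qed.

End gauss.

Section imass.
Context {R : realType}.
Implicit Types (P : probability (measurableTypeR R) R) (a b c : R).

Definition imass P a b : R := fine (P `[a, b[%classic).

Lemma imassE P a b : (imass P a b)%:E = P `[a, b[%classic.
Proof. by rewrite fineK// fin_num_measure. Qed.

Lemma imass_ge0 P a b : 0 <= imass P a b.
Proof. by rewrite fine_ge0. Qed.

Lemma imass_le1 P a b : imass P a b <= 1.
Proof. by rewrite -lee_fin imassE probability_le1. Qed.

Lemma imass_cat P a b c : a <= b -> b <= c ->
  imass P a c = imass P a b + imass P b c.
Proof.
move=> ab bc; apply: EFin_inj; rewrite EFinD !imassE -measureU//.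
  by congr (P _); rewrite -itv_bndbnd_setU// bnd_simp.
by apply/seteqP; split => // x /=; rewrite !in_itv/= => -[/andP[_ +] /andP[+ _]]; case: ltP.
Qed.

End imass.

Section standard_normal.
Context {R : realType}.
Notation mu := (@lebesgue_measure R).
Notation phi := (normal_pdf (0 : R) 1).
Notation std := [the probability (measurableTypeR R) R of normal_prob (0:R) 1].
Notation Phi := (imass std).

Lemma normal_pdf_mono (x y : R) : `|x| <= `|y| -> phi y <= phi x.
Proof.
move=> xy; rewrite !normal_pdfE ?oner_eq0//.
rewrite ler_wpM2l ?normal_peak_ge0// /normal_fun ler_expR !subr0.
rewrite ler_pM2r ?invr_gt0 ?expr1n ?mulr2n ?addr_gt0//.
by rewrite lerN2 -(real_normK (num_real x)) -(real_normK (num_real y)) lerXn2r ?nnegrE.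
Qed.

Lemma normal_pdfN (x : R) : phi (- x) = phi x.
Proof. by apply/le_anti; rewrite !normal_pdf_mono ?normrN. Qed.

Let mphi (D : set R) : measurable_fun D (fun x => (phi x)%:E).
Proof.
by apply: measurable_funTS; apply/measurable_EFinP; exact: measurable_normal_pdf.
Qed.

Let phi0 (x : R) : (0 <= (phi x)%:E)%E.
Proof. by rewrite lee_fin normal_pdf_ge0. Qed.

Let lebesgue_co (a b : R) : a <= b -> mu `[a, b[%classic = (b - a)%:E.
Proof.
by move=> ab; rewrite lebesgue_measure_itv/= lte_fin; case: ltgtP ab => // -> _; rewrite subrr.
Qed.

Lemma stdmass_le (a b : R) : 0 <= a -> a <= b -> Phi a b <= (b - a) * phi a.
Proof.
move=> a0 ab; rewrite -lee_fin imassE /= /normal_prob mulrC EFinM -lebesgue_co//.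
rewrite -integral_cst//; apply: ge0_le_integral => //; try exact: mphi.
move=> x/=; rewrite in_itv/= => /andP[ax _]; rewrite lee_fin normal_pdf_mono//.
by rewrite !ger0_norm// (le_trans a0).
Qed.

Lemma stdmass_ge (a b : R) : 0 <= a -> a <= b -> (b - a) * phi b <= Phi a b.
Proof.
move=> a0 ab; rewrite -lee_fin imassE /= /normal_prob mulrC EFinM -lebesgue_co//.
rewrite -integral_cst//; apply: ge0_le_integral => //; try exact: mphi.
  by move=> x _; exact: phi0.
move=> x/=; rewrite in_itv/= => /andP[ax xb]; rewrite /cst lee_fin normal_pdf_mono//.
by rewrite !ger0_norm ?(le_trans a0)// ltW.
Qed.

(** The mean density over [x, x + h[ is at most that over [0, x[, as the density
    at x separates them. Every use of unimodality below goes through this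
    inequality, which is linear in the law and so passes to mixtures. *)
Lemma stdmass_slope (x h : R) : 0 <= x -> 0 <= h ->
  x * Phi x (x + h) <= h * Phi 0 x.
Proof.
move=> x0 h0.
have := stdmass_le x0 (_ : x <= x + h); rewrite lerDl => /(_ h0).
have := stdmass_ge (lexx 0) x0.
rewrite subr0 addrAC subrr add0r => l u.
by apply: (le_trans (ler_wpM2l x0 u)); rewrite mulrCA ler_wpM2l.
Qed.

Lemma stdmassN (a b : R) : a <= b -> Phi (- b) (- a) = Phi a b.
Proof.
move=> ab; apply: EFin_inj; rewrite !imassE /= /normal_prob.
rewrite !integral_itv_bndo_bndc; [|exact: mphi..].
rewrite integration_by_substitution_oppr//.
  by apply: eq_integral => x _; rewrite /= normal_pdfN.
by apply: continuous_subspaceT; apply: continuous_normal_pdf; exact: oner_neq0.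
Qed.

(** The density drops by the factor exp (2 x + 2) >= 4 from x to x + 2. *)
Lemma normal_pdf_shift2 (x : R) : 0 <= x -> 4 * phi (2 + 1 * x) <= phi x.
Proof.
move=> x0; rewrite !normal_pdfE ?oner_eq0// mulrCA.
rewrite ler_wpM2l ?normal_peak_ge0// /normal_fun !subr0.
have e4 : 4 <= expR (2 : R).
  rewrite (_ : (2 : R) = 1 + 1)// expRD.
  by have := expR_ge1Dx (1 : R) => e2; nra.
apply: (@le_trans _ _ (expR 2 * expR (- (2 + 1 * x) ^+ 2 / (1 ^+ 2 *+ 2)))).
  by rewrite ler_wpM2r// expR_ge0.
rewrite -expRD ler_expR expr1n; nra.
Qed.

Let ray_tail : (normal_prob 0 1 `[2%R, +oo[%classic <=
  4^-1%:E * normal_prob (0:R) 1 `[0%R, +oo[%classic)%E.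
Proof.
have cphi : continuous phi by apply: continuous_normal_pdf; exact: oner_neq0.
rewrite /normal_prob.
have := integral_affine_ray 2 0 cphi (normal_pdf_ge0 0 1) ltr01.
rewrite mulr0 addr0 => ->.
rewrite -ge0_integralZl ?lee_fin ?invr_ge0//; try exact: mphi.
apply: ge0_le_integral => //.
- by move=> x _; rewrite lee_fin mulr1 normal_pdf_ge0.
- apply: measurable_funTS; apply/measurable_EFinP; apply: measurable_funM => //.
  apply: (measurableT_comp (measurable_normal_pdf 0 1)).
  by apply: continuous_measurable_fun; exact: continuous_affine.
- by apply: measurable_funeM; exact: mphi.
move=> x/=; rewrite in_itv/= andbT => x0.
rewrite -EFinM lee_fin mulr1 ler_pdivlMl//.
exact: normal_pdf_shift2.
Qed.

Lemma stdmass_central : 3 / 4 <= Phi (- 2) 2.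
Proof.
(* the line splits into the central interval and two tails, and each tail is at
   most a quarter of its half-line *)
have cphi : continuous phi by apply: continuous_normal_pdf; exact: oner_neq0.
pose L (a : R) := fine (std `]-oo, a[%classic).
pose U (a : R) := fine (std `[a, +oo[%classic).
have refl (a : R) : L (- a) = U a.
  congr fine; rewrite /= /normal_prob integral_itv_bndo_bndc; last exact: mphi.
  rewrite ge0_integration_by_substitutionNy.
  - by apply: eq_integral => x _; rewrite /= normal_pdfN.
  - exact: continuous_subspaceT.
  - by move=> x _; exact: normal_pdf_ge0.
have total (a b : R) : a <= b -> L a + Phi a b + U b = 1.
  move=> ab; apply: EFin_inj; rewrite !EFinD imassE !fineK ?fin_num_measure//.
  have dis1 : [disjoint `]-oo, a[%classic : set R & `[a, b[%classic].
    by apply: lt_disjoint => x y; rewrite !in_itv/= => xa /andP[ay _]; exact: lt_le_trans ay.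
  have dis2 : [disjoint (`]-oo, b[%classic : set R) & `[b, +oo[%classic].
    by apply: lt_disjoint => x y; rewrite !in_itv/= andbT => xa ay; exact: lt_le_trans ay.
  rewrite -measureU//; last exact/disj_set2P.
  rewrite -itv_bndbnd_setU// -measureU//; last exact/disj_set2P.
  by rewrite -itv_bndbnd_setU// set_itvNyy; exact: probability_setT.
have tail : U 2 <= 4^-1 * U 0.
  by rewrite -lee_fin EFinM !fineK ?fin_num_measure//; exact: ray_tail.
have L0 := refl 0; rewrite oppr0 in L0.
have := total 0 0 (lexx 0); have := total (- 2) 2; rewrite L0 refl.
have := imass_ge0 std 0 0; lra.
Qed.

End standard_normal.

(** * The normal components *)

Section normal_component.
Context {R : realType}.
Notation std := [the probability (measurableTypeR R) R of normal_prob (0:R) 1].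
Notation Phi := (imass std).

Lemma imass_normal_law (m s a b : R) : s != 0 -> a <= b ->
  imass (normal_law m s) (m + a) (m + b) = Phi (a / `|s|) (b / `|s|).
Proof. by move=> s0 ab; rewrite /imass normal_law_std. Qed.

Lemma imass_normal_law0 (m a b : R) :
  imass (normal_law m 0) (m + a) (m + b) = ((a <= 0) && (0 < b))%:R.
Proof.
rewrite /imass /normal_law eqxx /= /dirac /= indicE.
by rewrite mem_setE in_itv/= gerDl ltrDl.
Qed.

Lemma normal_law_slope (m s x h : R) : 0 < x -> 0 <= h ->
  x * imass (normal_law m s) (m + x) (m + (x + h)) <=
  h * imass (normal_law m s) m (m + x).
Proof.
move=> x0 h0; rewrite -[X in _ <= _ * imass _ X _]addr0.
have [->|s0] := eqVneq s 0.
  by rewrite !imass_normal_law0 (lt_geF x0)/= mulr0n mulr0 mulr_ge0.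
rewrite !imass_normal_law ?(ltW x0) ?lerDl//.
have s1 : 0 < `|s| by rewrite normr_gt0.
have := @stdmass_slope R (x / `|s|) (h / `|s|).
rewrite !divr_ge0 ?(ltW x0)// => /(_ isT isT).
by rewrite -mulrDl mul0r mulrAC [_ / _ * _]mulrAC ler_pM2r ?invr_gt0.
Qed.

Lemma normal_law_symmetric (m s a b : R) : s != 0 -> a <= b ->
  imass (normal_law m s) (m - b) (m - a) =
  imass (normal_law m s) (m + a) (m + b).
Proof.
move=> s0 ab; rewrite !imass_normal_law ?lerN2// !mulNr stdmassN//.
by rewrite ler_pM2r ?invr_gt0 ?normr_gt0.
Qed.

(** Only an inequality, because of the point mass: [0, b[ contains the centre and
    [-b, 0[ does not. *)
Lemma normal_law_reflect (m s a b : R) : 0 <= a -> a <= b ->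
  imass (normal_law m s) (m - b) (m - a) <=
  imass (normal_law m s) (m + a) (m + b).
Proof.
move=> a0 ab; have [->|s0] := eqVneq s 0.
  by rewrite !imass_normal_law0 oppr_gt0 ltNge a0 andbF.
by rewrite normal_law_symmetric.
Qed.

(** By unimodality the mass of [-w, w[ is at least w / W times that of [-W, W[,
    which contains two standard deviations. *)
Lemma normal_law_central (m s w W : R) : 2 <= W -> 0 < w -> w <= W ->
  `|s| <= 1 ->
  3 / 4 * w <= W * imass (normal_law m s) (m - w) (m + w).
Proof.
move=> W2 w0 wW s1; have [->|s0] := eqVneq s 0.
  rewrite imass_normal_law0 oppr_le0 (ltW w0) w0 mulr1; lra.
have sg0 : 0 < `|s| by rewrite normr_gt0.
rewrite imass_normal_law //; last lra.
set k := `|s| in s1 sg0 *.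
have v0 : 0 < w / k by rewrite divr_gt0.
have vV : w / k <= W / k by rewrite ler_pM2r ?invr_gt0.
have V2 : 2 <= W / k by rewrite ler_pdivlMr//; nra.
suff : 3 / 4 * (w / k) <= W / k * Phi (- w / k) (w / k).
  by rewrite mulrA [W / k * _]mulrAC ler_pM2r ?invr_gt0.
rewrite mulNr; move: (w / k) (W / k) v0 vV V2 => v V v0 vV V2.
have := @stdmass_central R; have := @stdmass_slope R v (V - v) (ltW v0).
have := stdmassN (ltW v0); have := stdmassN (le_trans (ltW v0) vV).
have := @imass_cat R std; have := @imass_ge0 R std; rewrite oppr0.
move: (imass std) => F F0 cat symV symv slope central.
rewrite subr_ge0 addrCA subrr addr0 in slope; move: (slope vV) => {}slope.
have catv : F 0 V = F 0 v + F v V by apply: cat => //; exact: ltW.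
have catvv : F (- v) v = F (- v) 0 + F 0 v by apply: cat; lra.
have catV : F (- V) V = F (- V) 0 + F 0 V by apply: cat; lra.
have cat2 : F (- V) V = F (- V) (- 2) + F (- 2) V by apply: cat; lra.
have cat22 : F (- 2) V = F (- 2) 2 + F 2 V by apply: cat; lra.
have half : 3 / 8 <= F 0 V by have := F0 (- V) (- 2); have := F0 2 V; lra.
have := ler_wpM2l (ltW v0) half; nra.
Qed.

Lemma normal_law_unimodal (m s w x : R) : 0 < w -> w <= x ->
  imass (normal_law m s) (m + x) (m + (x + 2 * w)) <=
  imass (normal_law m s) (m - w) (m + w).
Proof.
move=> w0 wx; have [->|s0] := eqVneq s 0.
  by rewrite !imass_normal_law0 (lt_geF (lt_le_trans w0 wx)) mulr0n ler0n.
have := normal_law_symmetric m s0 (ltW w0); rewrite oppr0 !addr0.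
have := @normal_law_slope m s x (2 * w) (lt_le_trans w0 wx).
have := @normal_law_slope m s w (x - w) w0.
have := @imass_cat R (normal_law m s).
rewrite (addrC x (- w)) addNKr (addrC (- w) x).
move: (imass _) => F cat sl1 sl2 sym.
have {}sl1 : w * F (m + w) (m + x) <= (x - w) * F m (m + w) by apply: sl1; lra.
have {}sl2 : x * F (m + x) (m + (x + 2 * w)) <= 2 * w * F m (m + x).
  by apply: sl2; lra.
have c1 : F m (m + x) = F m (m + w) + F (m + w) (m + x) by apply: cat; lra.
have c2 : F (m - w) (m + w) = F (m - w) m + F m (m + w) by apply: cat; lra.
rewrite c2 sym -(ler_pM2l (lt_le_trans w0 wx)).
rewrite c1 in sl2; apply: (le_trans sl2); nra.
Qed.

(** A central interval has more mass than a far one of the same length, for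
    every scale. For scales at most 1 the excess is quantitative: the central
    mass is at least (3 / 4) (w / W), and the far mass is at most 2 w / x. *)
Lemma normal_law_gap (m s w x W : R) : 2 <= W -> 0 < w -> w <= W ->
  8 * W <= 3 * x ->
  imass (normal_law m s) (m + x) (m + (x + 2 * w)) +
    w * (3 / (4 * W) - 2 / x) * \1_(`[0, 1]%classic : set R) s <=
  imass (normal_law m s) (m - w) (m + w).
Proof.
move=> W2 w0 wW Wx.
have x0 : 0 < x by lra.
rewrite indicE mem_setE in_itv/=; case: (boolP (_ && _)) => [/andP[s0 s1]|_]; last first.
  by rewrite mulr0n mulr0 addr0 normal_law_unimodal//; lra.
have far : imass (normal_law m s) (m + x) (m + (x + 2 * w)) <= 2 * w / x.
  rewrite ler_pdivlMr// mulrC.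
  apply: (le_trans (@normal_law_slope m s x (2 * w) x0 _)); first lra.
  by rewrite ler_piMr ?imass_le1//; lra.
have near : 3 / 4 * w / W <= imass (normal_law m s) (m - w) (m + w).
  rewrite ler_pdivrMr; last lra.
  by rewrite [leRHS]mulrC normal_law_central// ger0_norm.
rewrite mulr1n mulr1.
have -> : w * (3 / (4 * W) - 2 / x) = 3 / 4 * w / W - 2 * w / x.
  by field; apply/andP; split; apply: lt0r_neq0; lra.
lra.
Qed.

End normal_component.

(** * The scale mixture *)

Section mixture.
Context {R : realType}.
Variable G : probability (measurableTypeR R) R.

Lemma imass_normal_law_shift (m s a b : R) :
  imass (normal_law m s) (m + a) (m + b) = imass (normal_law 0 s) a b.
Proof.
have [ab|ba] := leP a b; last first.
  by rewrite /imass !set_itv_ge ?measure0// bnd_simp -leNgt ?lerD2l ltW.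
rewrite -[in RHS](add0r a) -[in RHS](add0r b).
have [->|s0] := eqVneq s 0; first by rewrite !imass_normal_law0.
by rewrite !imass_normal_law.
Qed.

Lemma scale_mixtureE (m a b : R) :
  (scale_mixture m G `[a, b[%classic =
   \int[G]_s (imass (normal_law m s) a b)%:E)%E.
Proof. by apply: eq_integral => s _; rewrite imassE. Qed.

Lemma imass_scale_mixture_shift (m a b : R) :
  imass (scale_mixture m G) (m + a) (m + b) = imass (scale_mixture 0 G) a b.
Proof.
rewrite /imass /= !scale_mixtureE; congr fine.
by apply: eq_integral => s _; rewrite imass_normal_law_shift.
Qed.

Lemma measurable_imass_normal_law (m a b : R) :
  measurable_fun [set: measurableTypeR R]
    (fun s => (imass (normal_law m s) a b)%:E).
Proof.
under eq_fun do rewrite imassE.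
exact: measurable_normal_law.
Qed.

(** Linear inequalities between interval masses pass from the components to the
    mixture; the indicator carries an excess available for scales in [0, 1], and
    turns into the weight of these scales. *)
Lemma scale_mixture_le (u v c p a b a' b' : R) : 0 <= u -> 0 <= v -> 0 <= c ->
  (p%:E <= G `[0%R, 1%R]%classic)%E ->
  (forall s, u * imass (normal_law 0 s) a b + c * \1_(`[0, 1]%classic : set R) s <=
     v * imass (normal_law 0 s) a' b') ->
  u * imass (scale_mixture 0 G) a b + c * p <=
  v * imass (scale_mixture 0 G) a' b'.
Proof.
move=> u0 v0 c0 pG le_s.
rewrite -lee_fin EFinD !EFinM !imassE /= !scale_mixtureE.
apply: (@le_trans _ _ (u%:E * \int[G]_s (imass (normal_law 0 s) a b)%:E +
    c%:E * \int[G]_s (\1_(`[0, 1]%classic : set R) s)%:E)%E).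
  rewrite leeD2l// lee_wpmul2l ?lee_fin//.
  by rewrite integral_indic// setIT.
have mI : measurable_fun [set: measurableTypeR R]
    (fun s => (\1_(`[0, 1]%classic : set R) s)%:E : \bar R).
  by apply/measurable_EFinP; exact: measurable_indic.
have mN k x y : measurable_fun [set: measurableTypeR R]
    (fun s => k%:E * (imass (normal_law 0 s) x y)%:E)%E.
  by apply: measurable_funeM; exact: measurable_imass_normal_law.
have N0 k x y s : 0 <= k -> (0 <= k%:E * (imass (normal_law 0 s) x y)%:E)%E.
  by move=> k0; rewrite -EFinM lee_fin mulr_ge0 ?imass_ge0.
rewrite -!ge0_integralZl//; try exact: measurable_imass_normal_law;
  try (by move=> s _; rewrite lee_fin imass_ge0).
rewrite -ge0_integralD//; last 3 first.
- by move=> s _; exact: N0.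
- by move=> s _; rewrite -EFinM lee_fin mulr_ge0.
- by apply: measurable_funeM.
apply: ge0_le_integral => //.
- by move=> s _; rewrite adde_ge0 ?N0// -EFinM lee_fin mulr_ge0.
- by apply: emeasurable_funD => //; exact: measurable_funeM.
by move=> s _; rewrite -!EFinM -EFinD lee_fin.
Qed.

Notation F := (imass (scale_mixture 0 G)).

Lemma scale_mixture_slope (x h : R) : 0 < x -> 0 <= h ->
  x * F x (x + h) <= h * F 0 x.
Proof.
move=> x0 h0.
have := @scale_mixture_le x h 0 0 x (x + h) 0 x (ltW x0) h0 (lexx 0).
rewrite mul0r addr0; apply; first by [].
by move=> s; have := normal_law_slope 0 s x0 h0; rewrite mul0r addr0 !add0r.
Qed.

Lemma scale_mixture_reflect (a b : R) : 0 <= a -> a <= b ->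
  F (- b) (- a) <= F a b.
Proof.
move=> a0 ab.
have := @scale_mixture_le 1 1 0 0 (- b) (- a) a b ler01 ler01 (lexx 0).
rewrite mul0r addr0 !mul1r; apply; first by [].
by move=> s; have := normal_law_reflect 0 s a0 ab; rewrite mul0r addr0 !mul1r !add0r.
Qed.

Lemma scale_mixture_gap (p w x W : R) :
  (p%:E <= G `[0%R, 1%R]%classic)%E ->
  2 <= W -> 0 < w -> w <= W -> 8 * W <= 3 * x ->
  F x (x + 2 * w) + w * (3 / (4 * W) - 2 / x) * p <= F (- w) w.
Proof.
move=> pG W2 w0 wW Wx.
have c0 : 0 <= w * (3 / (4 * W) - 2 / x).
  rewrite mulr_ge0 ?(ltW w0)// subr_ge0 ler_pdivrMr; last lra.
  rewrite mulrAC ler_pdivlMr; lra.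
have := @scale_mixture_le 1 1 _ p x (x + 2 * w) (- w) w ler01 ler01 c0 pG.
rewrite !mul1r; apply => s; rewrite !mul1r.
by have := normal_law_gap 0 s W2 w0 wW Wx; rewrite !add0r.
Qed.

End mixture.

(** * Separation of a profile from its shift *)

(** A lower bound for what [a, b[ contributes to the squared Hellinger distance
    between the law with interval masses F and its translate by D. *)
Definition sqrt_gap (R : rcfType) (F : R -> R -> R) (D a b : R) : R :=
  (Num.sqrt (F a b) - Num.sqrt (F (a + D) (b + D))) ^+ 2.

Section shift.
Context {R : realType}.

(** Exchanging an interval and its shift exchanges the two signs of m1 - m2. *)
Lemma sqrt_gap_le_hellinger (G : probability (measurableTypeR R) R)
    (m1 m2 t : R) :
  (hellinger2 (scale_mixture m1 G) (scale_mixture m2 G) <= t%:E)%E ->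
  forall a b a' b', b <= a' ->
    sqrt_gap (imass (scale_mixture 0 G)) `|m1 - m2| a b +
    sqrt_gap (imass (scale_mixture 0 G)) `|m1 - m2| a' b' <= t.
Proof.
move=> H2 a b a' b' ba'.
have shifted e f e' f' : f <= e' ->
    sqrt_gap (imass (scale_mixture 0 G)) (m1 - m2) e f +
    sqrt_gap (imass (scale_mixture 0 G)) (m1 - m2) e' f' <= t.
  move=> fe'; rewrite -lee_fin; apply: le_trans H2.
  pose A x y := `[m1 + x, m1 + y[%classic : set (measurableTypeR R).
  have dis : [disjoint A e f & A e' f'].
    apply: lt_disjoint => x y; rewrite /A/= !in_itv/= => /andP[_ xf] /andP[ey _].
    by apply: (lt_le_trans xf); apply: le_trans ey; rewrite lerD2l.
  have A1 x y : fine (scale_mixture m1 G (A x y)) = imass (scale_mixture 0 G) x y.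
    exact: imass_scale_mixture_shift.
  have A2 x y : fine (scale_mixture m2 G (A x y)) =
      imass (scale_mixture 0 G) (x + (m1 - m2)) (y + (m1 - m2)).
    rewrite -(imass_scale_mixture_shift G m2) /A.
    have E z : m2 + (z + (m1 - m2)) = m1 + z by rewrite addrCA subrKC addrC.
    by rewrite !E.
  have := hellinger2_ge_disjoint (scale_mixture m1 G) (scale_mixture m2 G) _ _ dis.
  by rewrite !A1 !A2; apply; exact: measurable_itv.
have [_|lt0] := ger0P (m1 - m2); first exact: shifted.
have swap e f : sqrt_gap (imass (scale_mixture 0 G)) (- (m1 - m2)) e f =
    sqrt_gap (imass (scale_mixture 0 G)) (m1 - m2) (e - (m1 - m2)) (f - (m1 - m2)).
  by rewrite /sqrt_gap !subrK -sqrrN opprB.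
by rewrite !swap shifted// lerD2r.
Qed.

End shift.

(** What the separation argument uses of the interval masses F of a scale mixture
    with weight p on the scales in [0, 1]. *)
Record profile (R : rcfType) (F : R -> R -> R) (p : R) : Prop := Profile {
  profile_ge0 : forall a b, 0 <= F a b;
  profile_le1 : forall a b, F a b <= 1;
  profile_cat : forall a b c, a <= b -> b <= c -> F a c = F a b + F b c;
  profile_slope : forall x h, 0 < x -> 0 <= h -> x * F x (x + h) <= h * F 0 x;
  profile_reflect : forall a b, 0 <= a -> a <= b -> F (- b) (- a) <= F a b;
  profile_gap : forall w x W, 2 <= W -> 0 < w -> w <= W -> 8 * W <= 3 * x ->
    F x (x + 2 * w) + w * (3 / (4 * W) - 2 / x) * p <= F (- w) w }.

Lemma scale_mixture_profile (R : realType)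
    (G : probability (measurableTypeR R) R) (p : R) :
  (p%:E <= G `[0%R, 1%R]%classic)%E -> profile (imass (scale_mixture 0 G)) p.
Proof.
move=> pG; split.
- by move=> a b; exact: imass_ge0.
- by move=> a b; exact: imass_le1.
- by move=> a b c; exact: imass_cat.
- by move=> x h; exact: scale_mixture_slope.
- by move=> a b; exact: scale_mixture_reflect.
- by move=> w x W; exact: scale_mixture_gap.
Qed.

Section separation.
Context {R : rcfType}.
Variables (F : R -> R -> R) (p D t : R).
Hypothesis F_profile : profile F p.
Let F_ge0 := profile_ge0 F_profile.
Let F_le1 := profile_le1 F_profile.
Let F_cat := profile_cat F_profile.
Let F_slope := profile_slope F_profile.
Let F_reflect := profile_reflect F_profile.
Let F_gap := profile_gap F_profile.
Hypothesis F_close : forall a b a' b', b <= a' ->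
  sqrt_gap F D a b + sqrt_gap F D a' b' <= t.
Hypothesis p_gt0 : 0 < p.
Hypothesis D_gt0 : 0 < D.

Let r := Num.sqrt t.

Let close1 a b : sqrt_gap F D a b <= t.
Proof.
by apply: le_trans (@F_close a b b b (lexx b)); rewrite lerDl sqr_ge0.
Qed.

Let t_ge0 : 0 <= t.
Proof. by apply: le_trans (close1 0 0); exact: sqr_ge0. Qed.

Let r_ge0 : 0 <= r := sqrtr_ge0 t.

Let r2 : r ^+ 2 = t.
Proof. exact: sqr_sqrtr. Qed.

Let sqrtF a b : Num.sqrt (F a b) ^+ 2 = F a b.
Proof. exact: sqr_sqrtr. Qed.

Let sqrt_sub a b : Num.sqrt (F a b) - Num.sqrt (F (a + D) (b + D)) <= r.
Proof.
have := close1 a b; rewrite /sqrt_gap -r2.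
set x := _ - _ => x2; apply: contraTle x2; rewrite -ltNge => rx.
by rewrite ltrXn2r ?(ltW rx)// (le_trans r_ge0 (ltW rx)).
Qed.

(** A - B = (sqrt A - sqrt B) (sqrt A + sqrt B): a large increment forces a large
    mass, and a mass at most 1 forces a small increment. *)
Lemma increment_le a b :
  F a b - F (a + D) (b + D) <= 2 * Num.sqrt (F a b) * r.
Proof.
have r0 := r_ge0.
have := sqrt_sub a b; rewrite -{2}(sqrtF a b) -{2}(sqrtF (a + D)).
have := sqrtr_ge0 (F a b); have := sqrtr_ge0 (F (a + D) (b + D)).
move: (Num.sqrt (F a b)) (Num.sqrt (F (a + D) (b + D))) => x y y0 x0 xyr.
have [xy|yx] := leP x y; last nra.
have : 0 <= x * r by rewrite mulr_ge0.
nra.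
Qed.

(** Passing from [0, +oo[ to its shift loses exactly F (0, D). The half-line is
    replaced by [0, T[ with T large, where the mass entering at the far end is at
    most D / T. *)
Lemma mass_shift_le : F 0 D <= 2 * r.
Proof.
have r0 := r_ge0; have D0 := D_gt0.
apply/ler_addgt0Pr => e e0.
have [T T0 De] : exists2 T, 0 < T & D = T * e.
  by exists (D / e); [rewrite divr_gt0|rewrite divfK// gt_eqF].
have incr := increment_le 0 T; rewrite add0r in incr.
have c1 : F 0 (T + D) = F 0 D + F D (T + D) by apply: F_cat; lra.
have c2 : F 0 (T + D) = F 0 T + F T (T + D) by apply: F_cat; lra.
have tail : F T (T + D) <= e.
  rewrite -(ler_pM2l T0) (le_trans (F_slope T0 (ltW D_gt0)))//.
  by rewrite -De ler_piMr ?F_le1// ltW.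
have : Num.sqrt (F 0 T) <= 1 by rewrite -sqrtr1 ler_sqrt.
nra.
Qed.

(** For A = F (-D/2, 48) the two estimates are p D / 96 <= sqrt A r, from the gap
    with w = D / 2, x = 48, W = 9, and D A <= 192 r, from [mass_shift_le]. The
    interval is asymmetric because a symmetric one of bounded length would only
    lose mass of order D^2 when D is small. *)
Lemma separation_small : D <= 18 -> p ^+ 2 * D ^+ 3 <= (192 * r) ^+ 3.
Proof.
have r0 := r_ge0; have D0 := D_gt0; have p0 := p_gt0.
move=> D18.
have gap := @F_gap (D / 2) 48 9; have incr := increment_le (- (D / 2)) 48.
have {}gap : F 48 (48 + D) + D / 48 * p <= F (- (D / 2)) (D / 2).
  have := gap _ _ _ _; rewrite (_ : 2 * (D / 2) = D); last by field.
  rewrite (_ : D / 2 * _ = D / 48); last by field.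
  by apply; lra.
have e1 : - (D / 2) + D = D / 2 by field.
rewrite e1 in incr.
set A := F (- (D / 2)) 48 in incr *.
have c1 : A = F (- (D / 2)) (D / 2) + F (D / 2) 48 by apply: F_cat; lra.
have c2 : F (D / 2) (48 + D) = F (D / 2) 48 + F 48 (48 + D) by apply: F_cat; lra.
have c3 : F (- 48) 48 = F (- 48) (- (D / 2)) + A by apply: F_cat; lra.
have c4 : F (- 48) 48 = F (- 48) 0 + F 0 48 by apply: F_cat; lra.
have c5 : F 0 48 = F 0 D + F D 48 by apply: F_cat; lra.
have refl : F (- 48) 0 <= F 0 48.
  by have := @F_reflect 0 48; rewrite oppr0; apply; lra.
have slope := @F_slope D (48 - D) D_gt0; rewrite addrCA subrr addr0 in slope.
have {}slope : D * F D 48 <= (48 - D) * F 0 D by apply: slope; lra.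
have tv := mass_shift_le.
have AD : D * A <= 192 * r.
  have A2 : A <= 2 * F 0 48 by have := F_ge0 (- 48) (- (D / 2)); lra.
  have := ler_wpM2l (ltW D_gt0) A2; rewrite c5; nra.
have lin : p * D <= 96 * (Num.sqrt A * r) by lra.
have sq : (p * D) ^+ 2 <= (96 * (Num.sqrt A * r)) ^+ 2.
  by rewrite lerXn2r ?nnegrE ?mulr_ge0 ?sqrtr_ge0 ?(ltW p_gt0) ?(ltW D_gt0).
have := ler_wpM2r (ltW D_gt0) sq.
rewrite !exprMn sqrtF -/A => sqD.
rewrite (_ : p ^+ 2 * D ^+ 3 = p ^+ 2 * D ^+ 2 * D); last by ring.
apply: (le_trans sqD).
rewrite (_ : _ * D = 96 ^+ 2 * r ^+ 2 * (D * A)); last by ring.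
apply: (@le_trans _ _ (96 ^+ 2 * r ^+ 2 * (192 * r))).
  by rewrite ler_wpM2l// mulr_ge0 ?sqr_ge0.
have : 0 <= r ^+ 3 by rewrite exprn_ge0.
rewrite (_ : _ * (192 * r) = 96 ^+ 2 * 192 * r ^+ 3); last by ring.
by move: (r ^+ 3) => z z0; lra.
Qed.

Let far_mass : 18 <= D -> (D - 2) * F (- 2 + D) (2 + D) <= 4 * F 0 D.
Proof.
move=> D18; have := @F_slope (D - 2) 4.
rewrite (_ : D - 2 + 4 = 2 + D); last by ring.
rewrite (addrC D (- 2)) => sl; have {}sl := sl _ _.
have c : F 0 D = F 0 (- 2 + D) + F (- 2 + D) D by apply: F_cat; lra.
have := F_ge0 (- 2 + D) D; rewrite c.
have : (- 2 + D) * F (- 2 + D) (2 + D) <= 4 * F 0 (- 2 + D) by apply: sl; lra.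
lra.
Qed.

Let gap_central : 18 <= D ->
  F (- 2 + D) (2 + D) + (3 / 4 - 4 / (D - 2)) * p <= F (- 2) 2.
Proof.
move=> D18; have := @F_gap 2 (D - 2) 2.
rewrite (_ : D - 2 + 2 * 2 = 2 + D); last by ring.
rewrite (_ : 2 * (3 / (4 * 2) - _) = 3 / 4 - 4 / (D - 2)); last first.
  by field; apply: lt0r_neq0; lra.
rewrite (addrC D (- 2)) => gap; apply: gap; lra.
Qed.

(** Write x, y for the square roots of the masses of [-2, 2[ and of its shift. The
    gap gives p <= 4 x r; as r^2 <= p / 8 this forces x >= 2 r, and since
    x - y <= r also y >= x / 2. So the shifted interval has mass of order
    (p / r)^2 as well, and unimodality makes this a bound on the mass of the
    whole of [0, D[, that is, one that grows with D. *)
Lemma separation_large : 18 <= D -> 8 * t <= p -> p ^+ 2 * D <= 576 * r ^+ 3.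
Proof.
have r0 := r_ge0; have D0 := D_gt0; have p0 := p_gt0.
move=> D18 tp; have far := far_mass D18; have := gap_central D18.
have incr := increment_le (- 2) 2; have sub := sqrt_sub (- 2) 2.
have B2 := sqrtF (- 2 + D) (2 + D).
have tv := mass_shift_le.
have d8 : 4 / (D - 2) <= 4^-1 by rewrite ler_pdivrMr; lra.
have x0 := sqrtr_ge0 (F (- 2) 2).
move: incr sub B2 far x0.
move: (Num.sqrt (F (- 2) 2)) (Num.sqrt (F (- 2 + D) (2 + D))) => x y.
move: (F (- 2) 2) (F (- 2 + D) (2 + D)) (F 0 D) tv => A B C tv incr sub B2 far x0 gap.
rewrite -B2 in incr far gap; rewrite -r2 in tp.
have dp : 4 / (D - 2) * p <= 4^-1 * p by rewrite ler_wpM2r// ltW.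
have pxr : p <= 4 * (x * r) by lra.
have r_gt0 : 0 < r.
  by rewrite lt_neqAle r_ge0 andbT; apply/eqP => r_eq0; move: pxr; rewrite -r_eq0 mulr0; lra.
have xr : 2 * r <= x by rewrite -(ler_pM2r r_gt0); nra.
have xy : x <= 2 * y by lra.
have pyr : p <= 8 * (y * r).
  by apply: (le_trans pxr); rewrite -subr_ge0 (_ : _ - _ = 4 * r * (2 * y - x)); [rewrite mulr_ge0 ?mulr_ge0 ?subr_ge0|ring].
have p2 : p ^+ 2 <= (8 * (y * r)) ^+ 2.
  by rewrite lerXn2r ?nnegrE ?(ltW p_gt0)// (le_trans (ltW p_gt0)).
have : p ^+ 2 * (D - 2) <= 64 * r ^+ 2 * ((D - 2) * y ^+ 2).
  have := ler_wpM2r (_ : 0 <= D - 2) p2; rewrite subr_ge0 => /(_ _).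
  rewrite (_ : (8 * (y * r)) ^+ 2 * (D - 2) = 64 * r ^+ 2 * ((D - 2) * y ^+ 2)); last by ring.
  by apply; lra.
have : 64 * r ^+ 2 * ((D - 2) * y ^+ 2) <= 64 * r ^+ 2 * (8 * r).
  rewrite ler_wpM2l ?mulr_ge0 ?sqr_ge0//; lra.
have : p ^+ 2 * (8 * D) <= p ^+ 2 * (9 * (D - 2)).
  by rewrite ler_wpM2l ?sqr_ge0//; lra.
have : r ^+ 3 = r ^+ 2 * r by ring.
lra.
Qed.

(** If p (D - 2) > 400, the central interval has mass at least 0.74 p while its two
    shifts have mass at most 0.01 p each, so the two contributions to the
    distance, of [-2, 2[ and of [-D - 2, -D + 2[, add up to at least
    2 (0.86 - 0.1)^2 p > p. A single one would not exceed t when t = p is close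
    to 1, which is why the disjoint pair is used. *)
Lemma separation_bounded : 18 <= D -> t <= p -> p <= 1 ->
  p * (D - 2) <= 400.
Proof.
have p0 := p_gt0.
move=> D18 tp p1; rewrite leNgt; apply/negP => big.
have D2 : 0 < D - 2 by lra.
have far : F (- 2 + D) (2 + D) <= p / 100.
  rewrite -(ler_pM2l D2) (le_trans (far_mass D18))//.
  by have := F_le1 0 D; nra.
have d4 : 4 / (D - 2) <= p / 100 by rewrite ler_pdivrMr//; lra.
have central : 74 / 100 * p <= F (- 2) 2.
  have := gap_central D18; have := F_ge0 (- 2 + D) (2 + D); nra.
have far' : F (- 2 - D) (2 - D) <= p / 100.
  apply: le_trans far; have := @F_reflect (- 2 + D) (2 + D).
  by rewrite !opprD opprK; apply; lra.
have := @F_close (- 2 - D) (2 - D) (- 2) 2; rewrite /sqrt_gap !subrK => close.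
have {}close := close _.
pose q := Num.sqrt p; have q0 : 0 < q by rewrite sqrtr_gt0.
have q2 : q ^+ 2 = p by rewrite sqr_sqrtr// ltW.
have x_ge : 86 / 100 * q <= Num.sqrt (F (- 2) 2).
  rewrite -(ler_pXn2r (_ : 0 < 2)%N) ?nnegrE ?sqrtr_ge0 ?mulr_ge0 ?(ltW q0)//; try lra.
  by rewrite sqrtF exprMn q2; lra.
have le_q a b : F a b <= p / 100 -> Num.sqrt (F a b) <= q / 10.
  move=> Fp; rewrite -(ler_pXn2r (_ : 0 < 2)%N) ?nnegrE ?sqrtr_ge0 ?divr_ge0 ?(ltW q0)//.
  by rewrite sqrtF expr_div_n q2; lra.
move: close (le_q _ _ far) (le_q _ _ far') x_ge.
move: (Num.sqrt (F (- 2) 2)) (Num.sqrt (F (- 2 + D) (2 + D)))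
  (Num.sqrt (F (- 2 - D) (2 - D))) => x y z close yq zq x_ge.
have {}close : (z - x) ^+ 2 + (x - y) ^+ 2 <= t by apply: close; lra.
have z2 : (76 / 100 * q) ^+ 2 <= (z - x) ^+ 2.
  by rewrite -[leRHS]sqrrN opprB lerXn2r ?nnegrE; lra.
have y2 : (76 / 100 * q) ^+ 2 <= (x - y) ^+ 2.
  by rewrite lerXn2r ?nnegrE; lra.
rewrite exprMn q2 in z2 y2; nra.
Qed.

End separation.

(** * The modulus of continuity *)

Lemma le_powR_root (R : realType) (n : nat) (x c X : R) : (0 < n)%N ->
  0 <= x -> 0 <= c -> 0 <= X -> x ^+ n <= c ^+ n * X ->
  x <= c * X `^ (1 / n%:R).
Proof.
move=> n0 x0 c0 X0; rewrite -{1}[X]powRr1//.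
have {1}-> : (1 : R) = (1 / n%:R) * n%:R by rewrite divfK// pnatr_eq0 -lt0n.
rewrite powRrM powR_mulrn ?powR_ge0// -exprMn ler_pXn2r// nnegrE.
by rewrite mulr_ge0 ?powR_ge0.
Qed.

Lemma powR_4_3 (R : realType) (p : R) : 0 <= p -> (p `^ (4 / 3)) ^+ 3 = p ^+ 4.
Proof.
move=> p0; rewrite -powR_mulrn ?powR_ge0// -powRrM divfK ?pnatr_eq0//.
exact: powR_mulrn.
Qed.

Section modulus.
Context {R : realType}.
Variables (t p : R) (G : probability (measurableTypeR R) R).
Hypothesis p_gt0 : 0 < p.
Hypothesis pG : (p%:E <= G `[0%R, 1%R]%classic)%E.

Lemma weight_le1 : p <= 1.
Proof. by rewrite -lee_fin (le_trans pG)// probability_le1. Qed.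

(** Squaring removes r = sqrt t from the first two separation estimates. *)
Lemma shift_separation (m1 m2 : R) :
  (hellinger2 (scale_mixture m1 G) (scale_mixture m2 G) <= t%:E)%E ->
  let D := `|m1 - m2| in
  [/\ D <= 18 -> D ^+ 6 <= 192 ^+ 6 * (t ^+ 3 / p ^+ 4),
     18 <= D -> 8 * t <= p -> D ^+ 2 <= 576 ^+ 2 * (t ^+ 3 / p ^+ 4) &
     18 <= D -> t <= p -> p * (D - 2) <= 400].
Proof.
move=> H2 D.
have t0 : 0 <= t.
  by rewrite -lee_fin (le_trans _ H2)// integral_ge0// => x _; rewrite lee_fin sqr_ge0.
have close := sqrt_gap_le_hellinger H2; rewrite -/D in close.
have prof := scale_mixture_profile pG.
have r6 : (Num.sqrt t ^+ 3) ^+ 2 = t ^+ 3 by rewrite exprAC sqr_sqrtr.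
have p4 : (p ^+ 2) ^+ 2 = p ^+ 4 by rewrite -exprM.
have p4_gt0 : 0 < p ^+ 4 by rewrite exprn_gt0.
have p2_ge0 : 0 <= p ^+ 2 by rewrite sqr_ge0.
have r3_ge0 : 0 <= Num.sqrt t ^+ 3 by rewrite exprn_ge0 ?sqrtr_ge0.
have D_ge0 : 0 <= D by exact: normr_ge0.
have square (a b : R) : 0 <= a -> p ^+ 2 * a <= b * Num.sqrt t ^+ 3 -> 0 <= b ->
    a ^+ 2 <= b ^+ 2 * (t ^+ 3 / p ^+ 4).
  move=> a0 ab b0; rewrite mulrA ler_pdivlMr// -p4 -r6 -!exprMn mulrC.
  by rewrite mulrC [a * _]mulrC lerXn2r// nnegrE mulr_ge0.
have [D0|Dn0] := eqVneq D 0.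
  rewrite D0; split=> // [_|le18|le18]; last 2 first; try lra.
  by rewrite expr0n/= mulr_ge0 ?divr_ge0 ?exprn_ge0// ltW.
have D_gt0 : 0 < D by rewrite lt_neqAle eq_sym Dn0.
split=> // [D18|D18 tp|D18 tp].
- have := separation_small prof close p_gt0 D_gt0 D18.
  rewrite exprMn => /square sq.
  by rewrite -[6%N]/(3 * 2)%N !exprM sq ?exprn_ge0.
- exact: (square _ _ D_ge0 (separation_large prof close p_gt0 D_gt0 D18 tp) (ler0n _ _)).
- exact: (separation_bounded prof close p_gt0 D18 tp weight_le1).
Qed.

End modulus.

Theorem lemma1p6 (R : realType) :
  exists C : R, 0 < C /\
    forall (t p : R) (G : probability (measurableTypeR R) R),
      0 <= t <= 1 ->
      G `[0%R, +oo[%classic = 1%E ->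
      0 < p ->
      (p%:E <= G `[0%R, 1%R]%classic)%E ->
      (t <= p `^ (4 / 3) ->
        (hellinger_modulus G t <= (C * (t ^+ 3 / p ^+ 4) `^ (1 / 6))%:E)%E) /\
      (p `^ (4 / 3) < t <= p / C ->
        (hellinger_modulus G t <= (C * (t ^+ 3 / p ^+ 4) `^ (1 / 2))%:E)%E).
Proof.
(* 192 and 576 come from the first two separation estimates; in the third case
   D <= 2 + 400 * 8 ^ 3 while X ^ (1 / 6) >= 1 / 3 *)
exists (100 ^+ 3); split; first by rewrite exprn_gt0.
move=> t p G /andP[t0 t1] _ p0 pG.
have p1 : p <= 1 := weight_le1 pG.
set X := t ^+ 3 / p ^+ 4.
have p4 : 0 < p ^+ 4 by rewrite exprn_gt0.
have X0 : 0 <= X by rewrite divr_ge0 ?exprn_ge0// ltW.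
have sixth : (1 / 6 : R) <= 1 / 2 by lra.
split=> [tp|/andP[tp tpC]]; apply: ge_ereal_sup => _ [m1 [m2 [H2 ->]]];
  rewrite lee_fin; have [small large bounded] := shift_separation p0 pG H2;
  move: small large bounded; rewrite -/X; set D := `|m1 - m2|;
  have D0 : 0 <= D := normr_ge0 _ => small large bounded.
- have tp3 : t ^+ 3 <= p ^+ 4.
    by rewrite -powR_4_3 ?(ltW p0)// lerXn2r// nnegrE powR_ge0.
  have X1 : X <= 1 by rewrite ler_pdivrMr// mul1r.
  have [D18|D18] := leP D 18.
    apply: (@le_trans _ _ (192 * X `^ (1 / 6))).
      exact: (le_powR_root (isT : 0 < 6)%N D0 (ler0n _ _) X0 (small D18)).
    by rewrite ler_wpM2r ?powR_ge0//; lra.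
  have [tp8|tp8] := leP (8 * t) p.
    apply: (@le_trans _ _ (576 * X `^ (1 / 6))).
      apply: (le_powR_root (isT : 0 < 6)%N D0 (ler0n _ _) X0).
      have D2 := large (ltW D18) tp8.
      have X3 : X ^+ 3 <= X by rewrite exprS ler_piMr// exprn_ile1.
      rewrite [D ^+ 6](exprM D 2 3) [_ ^+ 6](exprM _ 2 3).
      apply: (@le_trans _ _ ((576 ^+ 2 * X) ^+ 3)).
        rewrite lerXn2r// nnegrE; first exact: sqr_ge0.
        exact: (mulr_ge0 (sqr_ge0 _) X0).
      rewrite [leLHS]exprMn; exact: (ler_wpM2l (exprn_ge0 3 (sqr_ge0 _)) X3).
    by rewrite ler_wpM2r ?powR_ge0//; lra.
  have p3 : p ^+ 3 <= 8 ^+ 3 * t ^+ 3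
    by rewrite -exprMn lerXn2r ?nnegrE ?(mulr_ge0 (ler0n _ 8) t0) ?(ltW p0) ?(ltW tp8).
  (* from here on p and t are bounded below, hence so is X *)
  have p43 : p ^+ 4 <= p ^+ 3 by rewrite exprS ler_piMl// exprn_ge0// ltW.
  have t_le_p : t <= p.
    by rewrite -(ler_pXn2r (_ : 0 < 3)%N) ?nnegrE ?(ltW p0)// (le_trans tp3).
  have p_big : 1 <= 8 ^+ 3 * p.
    have p3_gt0 : 0 < p ^+ 3 by rewrite exprn_gt0.
    rewrite -(ler_pM2r p3_gt0) mul1r -mulrA -exprS (le_trans p3)//.
    by rewrite ler_wpM2l// exprn_ge0.
  have X_big : 1 <= 3 ^+ 6 * X.
    rewrite mulrA ler_pdivlMr// mul1r.
    have : 0 <= t ^+ 3 by rewrite exprn_ge0.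
    move: p3 p43; move: (p ^+ 4) (p ^+ 3) (t ^+ 3) => a b c; lra.
  have root_big : 1 <= 3 * X `^ (1 / 6).
    by apply: (le_powR_root (isT : 0 < 6)%N ler01 (ler0n _ _) X0); rewrite expr1n.
  have := bounded (ltW D18) t_le_p; have := ltW D18.
  nra.
- have X1 : 1 <= X.
    rewrite ler_pdivlMr// mul1r -powR_4_3 ?(ltW p0)// lerXn2r ?nnegrE ?powR_ge0//.
    exact: ltW.
  have [D18|D18] := leP D 18.
    apply: (@le_trans _ _ (192 * X `^ (1 / 6))).
      exact: (le_powR_root (isT : 0 < 6)%N D0 (ler0n _ _) X0 (small D18)).
    rewrite ler_pM ?powR_ge0//; first lra.
    exact: ler_powR.
  apply: (@le_trans _ _ (576 * X `^ (1 / 2))).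
    apply: (le_powR_root (isT : 0 < 2)%N D0 (ler0n _ _) X0 (large (ltW D18) _)).
    move: tpC; rewrite ler_pdivlMr ?exprn_gt0//; lra.
  by rewrite ler_wpM2r ?powR_ge0//; lra.
Qed.
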